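(* Let $q=p^f$ be a prime power and $n=2m$ an even positive integer. Let $Q:V=\mathbb{F}_q^n\to\mathbb{F}_q$ be a nonsingular quadratic form. Let $e\mid(q-1)$, let $\gamma$ be a primitive element of $\mathbb{F}_{q^2}$, $\omega=\gamma^{q+1}$, and $C_i^{(e,q)}=\omega^i\langle\omega^e\rangle$, $C_i^{(e,q^2)}=\gamma^i\langle\gamma^e\rangle$, $0\le i\le e-1$. Assume there is a partition $A_1,\ldots,A_d$ of $\{0,1,\ldots,e-1\}$ such that the decomposition of the complete graph on $\mathbb{F}_{q^2}$ into $\mathrm{Cay}(\mathbb{F}_{q^2},\bigcup_{\ell\in A_i}C_\ell^{(e,q^2)})$, $1\le i\le d$, is a fusion scheme of the $e$-class cyclotomic association scheme on $\mathbb{F}_{q^2}$. Then the decomposition of the complete graph on $V$ into $\mathrm{Cay}(V,D_0\setminus\{0\})$ and $\mathrm{Cay}(V,D_{\bigcup_{\ell\in A_i}C_\ell^{(e,q)}})$, $1\le i\le d$, gives a $(d+1)$-class association scheme, where $D_0=\{x\in V:Q(x)=0\}$ and $D_X=\{x\in V:Q(x)\in X\}$ for $X\subseteq\mathbb{F}_q$.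
   Context: A (symmetric) association scheme with $d$ classes on a finite set $X$ is a partition of $X\times X$ into relations $R_0,\ldots,R_d$ with $R_0=\{(x,x)\}$, each $R_i$ symmetric, and integers $p_{ij}^k$ with $|\{z:(x,z)\in R_i,(z,y)\in R_j\}|=p_{ij}^k$ for every $(x,y)\in R_k$. The $e$-class cyclotomic association scheme on $\mathbb{F}_{q^2}$ has relations $R_0$ and $R_{i+1}=\{(x,y):x-y\in C_i^{(e,q^2)}\}$, $0\le i\le e-1$; a fusion scheme of it is an association scheme whose non-diagonal relations are unions of these relations. A decomposition of the complete graph into graphs gives an association scheme if their edge relations together with the diagonal form one. $\mathrm{Cay}(G,D)$ has $x\sim y$ iff $x-y\in D$. A quadratic form is nonsingular if it cannot be written in fewer than $n$ variables after an invertible linear change of variables. *)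

(* Defs.v *)
From mathcomp Require Import all_boot all_order all_algebra.

Set Implicit Arguments.
Unset Strict Implicit.
Unset Printing Implicit Defensive.

Import GRing.Theory.
Local Open Scope ring_scope.

Definition fam_cons (T : Type) (d : nat) (x0 : T) (f : 'I_d -> T) :
    'I_d.+1 -> T :=
  fun k => if unlift ord0 k is Some i then f i else x0.

(* A relation on X, or the edge set of a graph on X, is a set of ordered pairs. *)
Definition diagonal (X : finType) : {set X * X} := [set xy | xy.1 == xy.2].

(* Symmetric association scheme with d classes.  The second clause says that *)
(* the relations partition X * X; it does not by itself exclude an empty *)
(* relation. *)
Definition association_scheme (X : finType) (d : nat)
    (R : 'I_d.+1 -> {set X * X}) : Prop :=
  [/\ R ord0 = diagonal X,
      forall xy : X * X, exists! i : 'I_d.+1, xy \in R i,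
      forall (i : 'I_d.+1) (x y : X), (x, y) \in R i -> (y, x) \in R i
    & exists p : 'I_d.+1 -> 'I_d.+1 -> 'I_d.+1 -> nat,
      forall (i j k : 'I_d.+1) (x y : X), (x, y) \in R k ->
        #|[set z | ((x, z) \in R i) && ((z, y) \in R j)]| = p i j k].

Definition fusion_scheme (X : finType) (e d : nat)
    (R : 'I_e.+1 -> {set X * X}) (S : 'I_d.+1 -> {set X * X}) : Prop :=
  association_scheme S /\
  forall i : 'I_d.+1, i != ord0 ->
    exists B : {set 'I_e.+1}, S i = \bigcup_(j in B) R j.

Definition graphs_rel (X : finType) (d : nat) (E : 'I_d -> {set X * X}) :
    'I_d.+1 -> {set X * X} :=
  fam_cons (diagonal X) E.

Definition Cay (G : finZmodType) (D : {set G}) : {set G * G} :=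
  [set xy | xy.1 - xy.2 \in D].

(* The coset g^i <g^e>.  For g != 0 the order of g is less than #|L|, so the *)
(* exponents k < #|L| exhaust the powers of g^e. *)
Definition cyclo_class (L : finFieldType) (g : L) (e i : nat) : {set L} :=
  [set g ^+ i * (g ^+ e) ^+ k | k : 'I_#|L|].

Definition cyclotomic_rel (L : finFieldType) (g : L) (e : nat) :
    'I_e.+1 -> {set L * L} :=
  graphs_rel (fun i : 'I_e => Cay (cyclo_class g e i)).

Definition cyclo_union (L : finFieldType) (g : L) (e : nat) (A : {set 'I_e}) :
    {set L} :=
  \bigcup_(l in A) cyclo_class g e l.

(* Quadratic forms are sum_(i, j) a_ij x_i x_j; A need not be symmetric, so *)
(* that characteristic 2 is covered. *)
Definition quadratic_form (F : fieldType) (n : nat) (Q : 'rV[F]_n -> F) : Prop :=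
  exists A : 'M[F]_n,
    forall x : 'rV[F]_n, Q x = \sum_(i < n) \sum_(j < n) A i j * x 0 i * x 0 j.

(* After the change of variables x |-> x *m P, Q is a quadratic form in the *)
(* first k < n variables.  Functions and homogeneous quadratic polynomials *)
(* correspond bijectively over every field, F_2 included. *)
Definition nonsingular (F : fieldType) (n : nat) (Q : 'rV[F]_n -> F) : Prop :=
  ~ exists (k : nat) (ltkn : (k < n)%N) (P : 'M[F]_n) (Q' : 'rV[F]_k -> F),
      [/\ P \in unitmx,
          quadratic_form Q'
        & forall x : 'rV[F]_n,
            Q (x *m P) = Q' (\row_(i < k) x 0 (widen_ord (ltnW ltkn) i))].

Definition level_set (F : finFieldType) (n : nat) (Q : 'rV[F]_n -> F)
    (X : {set F}) : {set 'rV[F]_n} :=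
  [set x | Q x \in X].

Definition form_graphs (F : finFieldType) (n : nat) (Q : 'rV[F]_n -> F)
    (w : F) (e d : nat) (A : 'I_d -> {set 'I_e}) :
    'I_d.+1 -> {set 'rV[F]_n * 'rV[F]_n} :=
  fam_cons (Cay (level_set Q [set 0] :\ 0))
           (fun i : 'I_d => Cay (level_set Q (cyclo_union w (A i)))).

(* Main.v *)
(* Write [B] for the polar form of [Q].  For [Q v = c != 0], the number of [u]
   with [B u v = t] and [Q u = b] depends only on the number of roots of
   [c X^2 + t X + b] in F: substituting [u + s v] for [u] translates the
   polynomial, and scaling [u] rescales it.  Moreover this number is an affine
   function of the number of roots, with coefficients depending only on the
   dimension 2m and on the number of zeros of [Q].  Hence, for X, Y subsets of F,
   the number of [u] with [Q (v - u)] in X and [Q u] in Y is an affine function of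
   a quantity determined by [c], X, Y alone.  The norm form of F_{q^2} / F_q is
   the case m = 1, and its level sets are the cyclotomic classes, so the
   intersection numbers assumed for F_{q^2} carry over to V.  For isotropic
   nonzero [v] the count does not depend on [v] at all. *)
Require Import Defs.
From HB Require Import structures.
From mathcomp Require Import all_boot all_order all_algebra perm finfield zify ring.

Set Implicit Arguments.
Unset Strict Implicit.
Unset Printing Implicit Defensive.

Import GRing.Theory Num.Theory.
Local Open Scope ring_scope.

(** * Counting by fibres, injections and bijections *)

Lemma card_fibers (S T : finType) (g : S -> T) (A : {pred S}) :
  #|A| = (\sum_y #|[set x in A | g x == y]|)%N.
Proof.
rewrite -sum1_card (partition_big g predT) //=; apply: eq_bigr => y _.
by rewrite -sum1_card; apply: eq_bigl => x; rewrite inE.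
Qed.

Lemma leq_card_inj (S T : finType) (g : S -> T) (A : {set S}) (B : {set T}) :
  injective g -> {in A, forall x, g x \in B} -> (#|A| <= #|B|)%N.
Proof.
move=> injg AB; rewrite -(card_imset (mem A) injg); apply/subset_leq_card.
by apply/subsetP => _ /imsetP[x Ax ->]; apply: AB.
Qed.

Lemma eq_card_bij (S T : finType) (g : S -> T) (h : T -> S)
    (A : {set S}) (B : {set T}) :
    cancel g h -> cancel h g -> (forall x, (x \in A) = (g x \in B)) ->
  #|A| = #|B|.
Proof.
move=> gK hK AB; apply/eqP; rewrite eqn_leq; apply/andP; split.
  by apply: (leq_card_inj (can_inj gK)) => x; rewrite AB.
by apply: (leq_card_inj (can_inj hK)) => y; rewrite AB hK.
Qed.

(** * Squares, binary forms and quadratic equations over a finite field *)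

Section FiniteField.
Variable F : finFieldType.
Implicit Types a b c s r x y : F.

(** Squaring is at most two-to-one, and 0 has a single square root, which makes the inequality
    strict. *)
Lemma card_squares : (#|F| < 2 * #|[set s ^+ 2 | s : F]|)%N.
Proof.
set S := [set _ | _ : _]; have S0 : 0 \in S by apply/imsetP; exists 0; rewrite ?expr0n.
rewrite (card_fibers (fun s => s ^+ 2) F) (bigD1 0) //=.
have fib y : (#|[set s | s ^+ 2 == y]| <= 2 * (y \in S))%N.
  case Sy: (y \in S).
    case/imsetP: Sy => s _ ->.
    apply: (@leq_trans #|[:: s; - s]|); last exact: card_size.
    by apply/subset_leq_card/subsetP => r; rewrite !inE eqf_sqr.
  rewrite muln0 leqn0 cards_eq0; apply/eqP/setP => s; rewrite !inE.
  by apply: contraFF Sy => /= /eqP <-; apply: imset_f.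
have -> : #|[set s : F | s ^+ 2 == 0]| = 1%N.
  by rewrite -(cards1 (0 : F)); congr #|pred_of_set _|; apply/setP => s; rewrite !inE expf_eq0.
have le : (\sum_(y : F | y != 0%R) #|[set s | s ^+ 2 == y]| <= 2 * #|S :\ 0%R|)%N.
  rewrite -sum1_card big_distrr /= big_mkcond [leqRHS]big_mkcond /=.
  apply: leq_sum => y _; rewrite !inE; case: eqP => //= _.
  by apply: leq_trans (fib y) _; case: (y \in S).
by move: le; have := cardsD1 0 S; rewrite S0 => ->; set a := bigop _ _ _; set b := #|_ :\ _|; lia.
Qed.

(** Pigeonhole: the values [c * s ^+ 2] and the values [b - c' * r ^+ 2] each fill more than half of
    the field, so they meet. *)
Lemma binary_form_onto c c' b : c != 0 -> c' != 0 ->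
  exists s r, c * s ^+ 2 + c' * r ^+ 2 = b.
Proof.
move=> c0 c'0; set S := [set s ^+ 2 | s : F].
pose A := [set c * x | x in S]; pose B : {set F} := [set b - c' * x | x in S].
have cA : #|A| = #|S| by apply/card_imset/mulfI.
have cB : #|B| = #|S|.
  by apply: card_imset => x y /addrI/oppr_inj/(mulfI c'0).
have : A :&: B != set0.
  rewrite -card_gt0; have := cardsUI A B; have := subset_leq_card (subsetT (A :|: B)).
  have := card_squares; rewrite -/S cA cB cardsT.
  by move: #|F| #|S| #|_ :|: _| #|_ :&: _| => *; lia.
case/set0Pn => z /setIP[/imsetP[_ /imsetP[s _ ->] ->] /imsetP[_ /imsetP[r _ ->]]] E.
by exists s, r; rewrite E subrK.
Qed.

(* The squares and [a] times the squares each contain 0 and more than half of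
   the field, so they meet only in 0 and cover everything. *)
Lemma nonsquare_ratio a b : (forall s, s ^+ 2 != a) -> (forall s, s ^+ 2 != b) ->
  exists s, b = s ^+ 2 * a.
Proof.
move=> na nb; have a0 : a != 0 by have := na 0; rewrite expr0n eq_sym.
set S := [set s ^+ 2 | s : F]; pose A := [set x * a | x in S].
have cA : #|A| = #|S| by apply/card_imset/mulIf.
have AS : A :&: S \subset [set 0].
  apply/subsetP => z /setIP[/imsetP[_ /imsetP[s _ ->] ->] /imsetP[r _ E]].
  rewrite inE; case: (eqVneq s 0) => [->|s0]; first by rewrite expr0n mul0r.
  case/eqP: (na (r / s)); rewrite expr_div_n -E mulrAC divff ?mul1r //.
  by rewrite expf_neq0.
have : b \in A :|: S.
  suff -> : A :|: S = setT by rewrite inE.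
  apply/eqP; rewrite eqEcard subsetT cardsT /=.
  have := cardsUI A S; have := subset_leq_card AS; rewrite cards1.
  have := card_squares; rewrite -/S cA.
  by move: #|F| #|S| #|_ :|: _| #|_ :&: _| => *; lia.
case/setUP => [/imsetP[_ /imsetP[s _ ->] ->]|/imsetP[s _ E]]; first by exists s.
by case/eqP: (nb s).
Qed.

Definition binary_count c c' b :=
  #|[set sr : F * F | c * sr.1 ^+ 2 + c' * sr.2 ^+ 2 == b]|.

(* The norm form [x^2 + d y^2], [d = c' / c], is multiplicative and represents
   every nonzero ratio [b' / b]. *)
Lemma binary_count_const c c' b b' : c != 0 -> c' != 0 -> b != 0 -> b' != 0 ->
  binary_count c c' b = binary_count c c' b'.
Proof.
move=> c0 c'0; pose d := c' / c.
have c'E : c' = c * d by rewrite mulrCA divff ?mulr1.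
suff le y z : y != 0 -> z != 0 -> (binary_count c c' y <= binary_count c c' z)%N.
  by move=> b0 b'0; apply/eqP; rewrite eqn_leq !le.
move=> y0 z0; have d0 : d != 0 by rewrite mulf_neq0 ?invr_eq0.
have [x1 [x2 Ex]] := binary_form_onto (z / y) (oner_neq0 F) d0.
have n0 : z / y != 0 by rewrite mulf_neq0 ?invr_eq0.
(* With [D ^+ 2 = - d] formally, [g] multiplies [s + r * D] by [x1 + x2 * D], of norm [z / y]; [h]
   multiplies by the conjugate and divides by that norm. *)
pose g (sr : F * F) := (sr.1 * x1 - d * sr.2 * x2, sr.1 * x2 + sr.2 * x1).
pose h (sr : F * F) := ((sr.1 * x1 + d * sr.2 * x2) / (z / y),
                        (sr.2 * x1 - sr.1 * x2) / (z / y)).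
apply: (@leq_card_inj _ _ g).
  apply: (can_inj (g := h)) => -[s r]; rewrite /h /=.
  by congr pair; apply: (mulIf n0); rewrite divfK //; rewrite -Ex; ring.
move=> [s r]; rewrite !inE /= => /eqP E.
apply/eqP; rewrite -[RHS](divfK y0) [RHS]mulrC -Ex -E c'E; ring.
Qed.

Definition quad_roots c t b := [set s | c * s ^+ 2 + t * s + b == 0].

(** The other root is [- (t / c) - s]; it differs from [s] exactly when the derivative
    [t + 2 * c * s] is nonzero. *)
Lemma card_quad_roots c t b s : c != 0 -> s \in quad_roots c t b ->
  #|quad_roots c t b| = (t + 2 * c * s != 0).+1.
Proof.
rewrite inE => c0 /eqP Es; pose s' := - (t / c) - s.
have -> : quad_roots c t b = [set s; s'].
  apply/setP => x; rewrite !inE -(subr_eq0 x s) -(subr_eq0 x s') -mulf_eq0.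
  rewrite -[RHS](inj_eq (mulfI c0)) mulr0; congr (_ == 0).
  rewrite -[LHS]subr0 -[X in _ - X]Es.
  suff -> : c * ((x - s) * (x - s')) = c * (x - s) * (x + s) + (t / c * c) * (x - s).
    by rewrite divfK //; ring.
  by rewrite /s'; ring.
rewrite cards2 -subr_eq0 -(inj_eq (mulfI c0)) mulr0; congr ((nat_of_bool (_ != 0)).+1).
have -> : c * (s - s') = t / c * c + 2 * c * s by rewrite /s'; ring.
by rewrite divfK.
Qed.

(** With [c] and [t] fixed, every [s] is a root for exactly one [b]. *)
Lemma sum_quad_roots c t : (\sum_b #|quad_roots c t b| = #|F|)%N.
Proof.
rewrite [RHS](card_fibers (fun s => - (c * s ^+ 2 + t * s))).
apply: eq_bigr => b _; apply: eq_card => s; rewrite !inE.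
by rewrite addr_eq0 -eqr_oppLR.
Qed.

(** In characteristic 2 squaring is additive with trivial kernel, hence injective, hence bijective
    on a finite field. *)
Lemma sqr_onto_char2 x : 2 = 0 :> F -> exists s, s ^+ 2 = x.
Proof.
move=> two0; have inj : injective (fun s : F => s ^+ 2).
  move=> s r /= E; suff /eqP : (s - r) ^+ 2 = 0 by rewrite expf_eq0 subr_eq0 => /eqP.
  suff -> : (s - r) ^+ 2 = s ^+ 2 - r ^+ 2 + 2 * (r ^+ 2 - s * r).
    by rewrite E two0 subrr mul0r addr0.
  by ring.
by have [g _ gK] := injF_bij inj; exists (g x); rewrite gK.
Qed.

(* In odd characteristic complete the square and apply [nonsquare_ratio]; in
   characteristic 2, [s |-> c s^2 + t s] is additive with image of index 2. *)
Lemma rootless_equiv c t b b' : c != 0 ->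
  quad_roots c t b = set0 -> quad_roots c t b' = set0 ->
  exists a s, [/\ a != 0, t = a * t + 2 * c * s &
                  b' = a ^+ 2 * b + s * (a * t) + s ^+ 2 * c].
Proof.
move=> c0 /setP nb /setP nb'.
have {}nb s : c * s ^+ 2 + t * s + b != 0 by have := nb s; rewrite !inE => ->.
have {}nb' s : c * s ^+ 2 + t * s + b' != 0 by have := nb' s; rewrite !inE => ->.
have [two0|two0] := eqVneq (2 : F) 0.
  pose g s := c * s ^+ 2 + t * s.
  (* [I] is at least half of the field, and [b] lies outside it; so the coset [J] is disjoint from
     [I] and the two exhaust the field. *)
  pose I : {set F} := [set g s | s : F]; pose J : {set F} := [set x + b | x in I].
  have cJ : #|J| = #|I| by apply/card_imset/addIr.
  have IJ : I :&: J \subset set0.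
    apply/subsetP => z /setIP[/imsetP[s _ ->] /imsetP[_ /imsetP[r _ ->]]] E.
    case/eqP: (nb (s - r)).
    have -> : c * (s - r) ^+ 2 + t * (s - r) + b =
              g s - (g r + b) + 2 * (c * r ^+ 2 - c * s * r + b) by rewrite /g; ring.
    by rewrite E subrr two0 mul0r addr0.
  have cI : (#|F| <= 2 * #|I|)%N.
    rewrite (card_fibers g F) mulnC -sum_nat_const.
    rewrite [leqRHS]big_mkcond; apply: leq_sum => y _; case: ifP => Iy.
      case/imsetP: Iy => s _ ->.
      apply: (@leq_trans #|quad_roots c t (- g s)|).
        by apply/subset_leq_card/subsetP => r; rewrite !inE subr_eq0.
      rewrite (@card_quad_roots c t _ s) ?inE ?subrr //.
      by case: (_ != 0).
    rewrite leqn0 cards_eq0; apply/eqP/setP => s; rewrite !inE.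
    by apply: contraFF Iy => /= /eqP <-; apply: imset_f.
  have : b' \in I :|: J.
    suff -> : I :|: J = setT by rewrite inE.
    apply/eqP; rewrite eqEcard subsetT cardsT /=.
    have := cardsUI I J; have := subset_leq_card IJ; rewrite cards0.
    by move: cI; rewrite cJ; move: #|F| #|I| #|_ :|: _| #|_ :&: _| => *; lia.
  case/setUP => [/imsetP[s _ E]|/imsetP[_ /imsetP[s _ ->] E]].
    case/eqP: (nb' s); rewrite -/(g s) -E -mulr2n -mulr_natl two0; exact: mul0r.
  exists 1, s; rewrite oner_neq0 two0; split=> //; first by ring.
  by rewrite E /g; ring.
have four0 : 4 * c != 0 by rewrite mulf_neq0 // -[4]/((2 * 2)%:R) natrM mulf_neq0.
(* [D x] is the discriminant [t ^+ 2 - 4 * c * x] divided by [(2 * c) ^+ 2], a nonsquare when the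
   polynomial with constant term [x] is rootless. *)
pose D x := - (x - t ^+ 2 / (4 * c)) / c.
have nsq x : (forall s, c * s ^+ 2 + t * s + x != 0) -> forall s, s ^+ 2 != D x.
  move=> nx s; apply: contra (nx (s - t / (2 * c))) => /eqP E.
  apply/eqP.
  have -> : x = - (c * D x) + t ^+ 2 / (4 * c).
    by rewrite /D; field; rewrite c0 -[4]/((2 * 2)%:R) natrM mulf_neq0.
  rewrite -E; field.
  by rewrite c0 two0 -[4]/((2 * 2)%:R) natrM mulf_neq0.
have [a Ea] := nonsquare_ratio (nsq _ nb) (nsq _ nb').
have a0 : a != 0.
  apply: contraTneq (nsq _ nb' 0) => a0.
  by rewrite Ea a0 expr0n mul0r eqxx.
(* The two discriminants have ratio [a ^+ 2], and [s] is forced by [t = a * t + 2 * c * s]. *)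
exists a, (t * (1 - a) / (2 * c)); split=> //.
  by field; rewrite c0.
have -> : b' = - (c * D b') + t ^+ 2 / (4 * c).
  by rewrite /D; field; rewrite c0 -[4]/((2 * 2)%:R) natrM mulf_neq0.
rewrite Ea /D; field.
by rewrite c0 two0 -[4]/((2 * 2)%:R) natrM mulf_neq0.
Qed.

End FiniteField.

(** * Quadratic spaces over a finite field *)

Definition polar (F : finFieldType) (V : finLmodType F) (Q : V -> F) (u v : V) :=
  Q (u + v) - Q u - Q v.

(** Linearity in the first argument is enough, the polar form being symmetric. *)
Definition quadratic_map (F : finFieldType) (V : finLmodType F) (Q : V -> F) :=
  (forall a v, Q (a *: v) = a ^+ 2 * Q v) /\
  (forall a u u' v, polar Q (a *: u + u') v = a * polar Q u v + polar Q u' v).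

Definition subspace (F : finFieldType) (V : finLmodType F) (U : {set V}) :=
  0 \in U /\ forall a u v, u \in U -> v \in U -> a *: u + v \in U.

Section QuadraticSpace.
Variables (F : finFieldType) (V : finLmodType F) (Q : V -> F).
Hypothesis Qquad : quadratic_map Q.
Local Notation B := (polar Q).
Implicit Types (u v w : V) (a b c s t : F) (U : {set V}).

Let Q_scale a v : Q (a *: v) = a ^+ 2 * Q v. Proof. exact: Qquad.1. Qed.

Let Q_0 : Q 0 = 0.
Proof. by rewrite -(scale0r (0 : V)) Q_scale expr0n mul0r. Qed.

Let B_C u v : B u v = B v u.
Proof. by rewrite /polar addrAC [v + u]addrC. Qed.

Let B_lin a u u' v : B (a *: u + u') v = a * B u v + B u' v.
Proof. exact: Qquad.2. Qed.

Let B_0l v : B 0 v = 0.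
Proof. by rewrite /polar add0r Q_0 subr0 subrr. Qed.

Let B_Zl a u v : B (a *: u) v = a * B u v.
Proof. by rewrite -[a *: u]addr0 B_lin B_0l addr0. Qed.

Let B_Dl u u' v : B (u + u') v = B u v + B u' v.
Proof. by rewrite -[u]scale1r B_lin mul1r scale1r. Qed.

Let Q_D u v : Q (u + v) = Q u + Q v + B u v.
Proof. by rewrite /polar; ring. Qed.

Let Q_line s u v : Q (u + s *: v) = Q u + s * B u v + s ^+ 2 * Q v.
Proof. by rewrite Q_D Q_scale B_C B_Zl B_C addrAC. Qed.

Let Q_N v : Q (- v) = Q v.
Proof. by rewrite -scaleN1r Q_scale sqrrN expr1n mul1r. Qed.

Let B_vv v : B v v = 2 * Q v.
Proof. by rewrite /polar -[v + v]/(v *+ 2) -scaler_nat Q_scale; ring. Qed.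

Let B_line s u v : B (u + s *: v) v = B u v + 2 * Q v * s.
Proof. by rewrite B_Dl B_Zl B_vv mulrC. Qed.

Lemma quadratic_sub u v : Q (v - u) = Q v + Q u - B u v.
Proof. by rewrite Q_D Q_N B_C -scaleN1r B_Zl mulN1r. Qed.

Definition perp U v := [set u in U | B u v == 0].

(** This concerns the polar form, not [Q]: in characteristic 2 a form that is anisotropic on a
    nonzero radical is nonsingular, yet degenerate in this sense. *)
Definition nondegenerate U :=
  forall u, u \in U -> (forall w, w \in U -> B u w = 0) -> u = 0.

Definition count_on U b := #|[set u in U | Q u == b]|.
Arguments count_on U b%_R.

Lemma perp_subspace U v : subspace U -> subspace (perp U v).
Proof.
case=> U0 US; split=> [|a u w]; first by rewrite inE U0 B_0l eqxx.
rewrite !inE => /andP[Uu /eqP u0] /andP[Uw /eqP w0].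
by rewrite US // B_lin u0 w0 mulr0 addr0 eqxx.
Qed.

Lemma subspaceD U a u v : subspace U -> u \in U -> v \in U -> v + a *: u \in U.
Proof. by case=> _ US Uu Uv; rewrite addrC US. Qed.

Lemma subspaceT : subspace [set: V].
Proof. by split=> *; rewrite inE. Qed.

(** Translations by multiples of [u0] permute the fibres of [B^~ v] on [U] transitively, so these
    [#|F|] fibres have equal size. *)
Lemma card_polar_fiber U u0 v t : subspace U -> u0 \in U -> B u0 v != 0 ->
  (#|[set u in U | B u v == t]| * #|F| = #|U|)%N.
Proof.
move=> sU Uu0 u0v.
have shift r : #|[set u in U | B u v == t]| = #|[set u in U | B u v == r]|.
  pose k := (r - t) / B u0 v.
  apply: (@eq_card_bij _ _ (fun u => u + k *: u0) (fun u => u + (- k) *: u0)).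
  - by move=> u; rewrite -addrA -scalerDl subrr scale0r addr0.
  - by move=> u; rewrite -addrA -scalerDl addNr scale0r addr0.
  move=> u; rewrite !inE B_Dl B_Zl divfK //; congr andb.
    apply/idP/idP => Uu; first exact: subspaceD.
    rewrite -[u]addr0 -(scale0r u0) -(subrr k) scalerDl addrA.
    exact: subspaceD.
  by rewrite -subr_eq0 -[in RHS]subr_eq0; congr (_ == 0); ring.
rewrite [RHS](card_fibers (B^~ v)) mulnC -sum_nat_const.
by apply: eq_bigr => r _; apply: shift.
Qed.

Lemma card_perp U u0 v : subspace U -> u0 \in U -> B u0 v != 0 ->
  (#|perp U v| * #|F| = #|U|)%N.
Proof. exact: card_polar_fiber. Qed.

(** If [Q] vanished on [U], so would its polar form, and all of [U] would be radical. *)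
Lemma exists_anisotropic U : subspace U -> nondegenerate U -> (1 < #|U|)%N ->
  exists2 u, u \in U & Q u != 0.
Proof.
move=> sU ndU cU; apply/exists_inP; apply: contraTT cU => /exists_inPn/= Qz.
rewrite -leqNgt; have U0 : U \subset [set 0]; last first.
  by rewrite -(cards1 (0 : V)) subset_leq_card.
apply/subsetP => u Uu; rewrite inE; apply/eqP/ndU => // w Uw.
have Qz' x : x \in U -> Q x = 0 by move/Qz; rewrite negbK => /eqP.
have Uuw : u + w \in U by rewrite addrC -[u]scale1r subspaceD.
by rewrite /polar !Qz' // !subr0.
Qed.

(** * Orthogonal splitting in odd characteristic *)

Section OddCharacteristic.
Hypothesis odd2 : 2 != 0 :> F.

(** Since [B v v = 2 * Q v] is nonzero, [U] is spanned by [v] and [perp U v]; a vector orthogonal to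
    both is orthogonal to [U]. *)
Lemma perp_nondegenerate U v : subspace U -> nondegenerate U -> v \in U ->
  Q v != 0 -> nondegenerate (perp U v).
Proof.
move=> sU ndU Uv Qv u; rewrite inE => /andP[Uu /eqP uv] ort.
have vv : B v v != 0 by rewrite B_vv mulf_neq0.
apply: ndU => // w Uw; pose k := - (B w v / B v v).
have kE : B w v + k * B v v = 0 by rewrite mulNr divfK // subrr.
have := ort (w + k *: v); rewrite !inE subspaceD // B_Dl B_Zl kE eqxx.
by rewrite B_C B_Dl B_Zl [B v u]B_C uv mulr0 addr0 B_C; apply.
Qed.

(** Each [w] in [U] is [s *: u] plus a vector of [perp U u], with [s = B w u / (2 * Q u)], and [Q]
    is additive on orthogonal sums. *)
Lemma count_on_split U u b : subspace U -> u \in U -> Q u != 0 ->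
  count_on U b = (\sum_s count_on (perp U u) (b - Q u * s ^+ 2)%R)%N.
Proof.
move=> sU Uu Qu; pose k w := B w u / (2 * Q u).
rewrite /count_on (card_fibers k); apply: eq_bigr => s _.
apply: (@eq_card_bij _ _ (fun w => w + (- s) *: u) (fun w => w + s *: u)).
- by move=> w; rewrite -addrA -scalerDl addNr scale0r addr0.
- by move=> w; rewrite -addrA -scalerDl subrr scale0r addr0.
have uu0 : 2 * Q u != 0 by rewrite mulf_neq0.
move=> w; rewrite !inE /k Q_line B_line -[RHS]andbA.
have -> : (B w u / (2 * Q u) == s) = (B w u + 2 * Q u * - s == 0).
  by rewrite -(inj_eq (mulIf uu0)) divfK // -subr_eq0 mulrN [s * _]mulrC.
have -> : (w + (- s) *: u \in U) = (w \in U).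
  apply/idP/idP => Uw; last exact: subspaceD.
  by rewrite -[w]addr0 -(scale0r u) -(addNr s) scalerDl addrA subspaceD.
rewrite -andbA; congr andb; rewrite andbC; case: eqP => //= E.
rewrite -subr_eq0 -[in RHS]subr_eq0; congr (_ == 0).
have -> : B w u = 2 * Q u * s by apply/eqP; rewrite -subr_eq0 -mulrN E.
ring.
Qed.

(* Splitting off an orthogonal pair leaves a complement on which the count is
   (constant) + (multiple of the indicator of 0), so only the count for a
   binary form matters. *)
Lemma count_on_even k U b b' : subspace U -> nondegenerate U ->
  #|U| = (#|F| ^ (2 * k))%N -> b != 0 -> b' != 0 -> count_on U b = count_on U b'.
Proof.
have q1 : (1 < #|F|)%N by exact: card_finNzRing_gt1.
elim: k U b b' => [|k IH] U b b' sU ndU cU b0 b'0.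
  have/eqP/cards1P[x Ux] : #|U| = 1%N by rewrite cU muln0.
  have x0 : x = 0 by case: sU; rewrite Ux inE => /eqP.
  suff Z (z : F) : z != 0 -> count_on U z = 0%N by rewrite !Z.
  move=> z0; apply: eq_card0 => u; rewrite Ux x0 !inE.
  by apply/andP => -[/eqP-> /eqP]; rewrite Q_0 => /eqP; rewrite eq_sym (negPf z0).
have c1 : (1 < #|U|)%N by rewrite cU -(expn0 #|F|) ltn_exp2l.
have [u Uu Qu] := exists_anisotropic sU ndU c1.
have Buu : B u u != 0 by rewrite B_vv mulf_neq0.
have cU1 := card_perp sU Uu Buu.
have sU1 := perp_subspace u sU; have ndU1 := perp_nondegenerate sU ndU Uu Qu.
have cU1' : #|perp U u| = (#|F| ^ (2 * k).+1)%N.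
  apply/eqP; rewrite -(eqn_pmul2r (ltnW q1)) cU1 cU -expnSr.
  by apply/eqP; congr expn; lia.
have c2 : (1 < #|perp U u|)%N by rewrite cU1' -(expn0 #|F|) ltn_exp2l.
have [w Uw Qw] := exists_anisotropic sU1 ndU1 c2.
have Bww : B w w != 0 by rewrite B_vv mulf_neq0.
have cU2 := card_perp sU1 Uw Bww.
have sU2 := perp_subspace w sU1; have ndU2 := perp_nondegenerate sU1 ndU1 Uw Qw.
set U2 := perp _ w in cU2 sU2 ndU2.
have cU2' : #|U2| = (#|F| ^ (2 * k))%N.
  by apply/eqP; rewrite -(eqn_pmul2r (ltnW q1)) cU2 cU1' -expnSr.
(* A pair [(s, r)] on the conic leaves the value 0 for [U2]; any other pair leaves a nonzero value,
   which by induction counts like 1. *)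
have E (z : F) : z != 0 -> count_on U z =
    (binary_count (Q u) (Q w) z * count_on U2 0 +
     (#|{: F * F}| - binary_count (Q u) (Q w) z) * count_on U2 1)%N.
  move=> z0; rewrite (count_on_split z sU Uu Qu).
  under eq_bigr => s _ do rewrite (count_on_split _ sU1 Uw Qw).
  set S := [set sr : F * F | Q u * sr.1 ^+ 2 + Q w * sr.2 ^+ 2 == z].
  rewrite pair_big /= (bigID (mem S)) /=.
  congr addn.
    rewrite -sum_nat_const; apply: eq_bigr => -[s r]; rewrite inE => /= /eqP<-.
    by congr count_on; ring.
  have -> : (#|{: F * F}| - binary_count (Q u) (Q w) z = #|~: S|)%N.
    by rewrite [RHS]cardsCs setCK.
  rewrite -sum_nat_const; apply: eq_big => -[s r]; rewrite !inE ?andbT //= => nz.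
  apply: IH; rewrite ?oner_neq0 // -addrA -opprD subr_eq0.
  by rewrite eq_sym.
by rewrite !E // (binary_count_const Qu Qw b0 b'0).
Qed.

End OddCharacteristic.

(** * Represented values, and the radical in characteristic 2 *)

Lemma quadratic_onto b : nondegenerate [set: V] -> (#|F| ^ 2 <= #|V|)%N ->
  b != 0 -> exists u, Q u = b.
Proof.
have q1 : (1 < #|F|)%N by exact: card_finNzRing_gt1.
move=> ndV cV b0; have sV := subspaceT.
have c1 : (1 < #|[set: V]|)%N.
  by rewrite cardsT (leq_trans _ cV) // -(expn0 #|F|) ltn_exp2l.
have [u Vu Qu] := exists_anisotropic sV ndV c1.
(* In characteristic 2 the multiples of [u] already take all values; otherwise two orthogonal
   anisotropic vectors give a binary form. *)
have [two0|two0] := eqVneq (2 : F) 0.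
  have [s Es] := sqr_onto_char2 (b / Q u) two0.
  by exists (s *: u); rewrite Q_scale Es divfK.
have Buu : B u u != 0 by rewrite B_vv mulf_neq0.
have cU := card_perp sV Vu Buu; rewrite cardsT in cU.
have c2 : (1 < #|perp [set: V] u|)%N.
  by rewrite (leq_trans q1) // -(leq_pmul2r (ltnW q1)) cU mulnn.
have [w Uw Qw] := exists_anisotropic (perp_subspace u sV)
  (perp_nondegenerate two0 sV ndV Vu Qu) c2.
have [s [r E]] := binary_form_onto b Qu Qw.
exists (s *: u + r *: w); move: Uw; rewrite !inE => /eqP wu.
by rewrite Q_line Q_scale B_Zl B_C wu !mulr0 addr0 -E mulrC [_ * Q w]mulrC.
Qed.

Definition radical U := [set u in U | [forall w in U, B u w == 0]].

Lemma radicalP U u : reflect (u \in U /\ forall w, w \in U -> B u w = 0) (u \in radical U).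
Proof.
rewrite inE; apply: (iffP andP) => -[Uu H]; split=> //.
  by move=> w Uw; apply/eqP; have /forall_inP := H; apply.
by apply/forall_inP => w Uw; rewrite H.
Qed.

(* In characteristic 2 the polar form is alternating: split off hyperbolic
   planes. *)
Lemma card_radical_char2 U : 2 = 0 :> F -> subspace U ->
  exists k, #|U| = (#|radical U| * #|F| ^ (2 * k))%N.
Proof.
move=> two0; have [h] := ubnP #|U|; elim: h U => // h IH U; rewrite ltnS => Uh sU.
have [Ur|] := boolP (U \subset radical U).
  exists 0%N; rewrite muln0 muln1; congr #|pred_of_set _|; apply/eqP.
  by rewrite eqEsubset Ur; apply/subsetP => u /radicalP[].
case/subsetPn => u Uu /radicalP nr.
have [w Uw Buw] : exists2 w, w \in U & B u w != 0.
  apply/exists_inP; rewrite -[X in is_true X]negbK; apply/negP => /exists_inPn/= H.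
  by apply: nr; split=> // w /H; rewrite negbK => /eqP.
have Buu : B u u = 0 by rewrite B_vv two0 mul0r.
have Bww : B w w = 0 by rewrite B_vv two0 mul0r.
have Bwu : B w u != 0 by rewrite B_C.
have cU1 := card_perp sU Uw Bwu.
have sU1 := perp_subspace u sU.
have U1u : u \in perp U u by rewrite inE Uu Buu eqxx.
have cU2 := card_perp sU1 U1u Buw.
have sU2 := perp_subspace w sU1.
set U2 := perp _ w in cU2 sU2.
have q1 : (1 < #|F|)%N by exact: card_finNzRing_gt1.
have U2_gt0 : (0 < #|U2|)%N by apply/card_gt0P; exists 0; case: sU2.
have cU : #|U| = (#|U2| * #|F| ^ 2)%N by rewrite -cU1 -cU2 -mulnA.
have U2h : (#|U2| < h)%N.
  by apply: leq_trans Uh; rewrite cU ltn_Pmulr // -(expn0 #|F|) ltn_exp2l.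
have [k Ek] := IH U2 U2h sU2.
exists k.+1; rewrite cU Ek mulnS addnC expnD mulnA; congr (#|pred_of_set _| * _ * _)%N.
apply/setP => x; apply/radicalP/radicalP => -[]; last first.
  move=> Ux H; split=> [|y]; first by rewrite !inE Ux !H // eqxx.
  by rewrite !inE => /andP[/andP[/H]].
rewrite !inE => /andP[/andP[Ux /eqP xu] /eqP xw] H; split=> // y Uy.
(* The projection of [y] to [U2] along the plane of [u] and [w], to which [x] is orthogonal. *)
pose y' := y + (- (B y u / B w u)) *: w + (- (B y w / B u w)) *: u.
have: B x y' = 0.
  apply: H; rewrite !inE /y' !subspaceD // !B_Dl !B_Zl Buu Bww !mulNr !divfK //.
  by rewrite !mulr0 !oppr0 !addr0 !subrr eqxx.
by rewrite /y' B_C !B_Dl !B_Zl ![B _ x]B_C xu xw !mulr0 !addr0.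
Qed.

(* In characteristic 2 the radical would be a line, since [Q] is injective and
   Frobenius-semilinear on it; but the radical has even codimension. *)
Lemma nondegenerate_even m : #|V| = (#|F| ^ (2 * m))%N ->
  (forall v, v != 0 -> (forall w, B v w = 0) -> Q v != 0) ->
  nondegenerate [set: V].
Proof.
move=> cV H v _ vr; apply/eqP; apply: contraT => v0.
have {}vr w : B v w = 0 by apply: vr; rewrite inE.
have Qv := H v v0 vr.
(* A radical vector satisfies [2 * Q v = B v v = 0], while [Q v] is nonzero. *)
have two0 : 2 = 0 :> F.
  by apply/eqP; have /eqP := vr v; rewrite B_vv mulf_eq0 (negPf Qv) orbF.
have q1 : (1 < #|F|)%N by exact: card_finNzRing_gt1.
have [k] := card_radical_char2 two0 subspaceT.
rewrite cardsT cV.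
have -> : radical [set: V] = [set s *: v | s : F].
  apply/setP => u; apply/radicalP/imsetP => [[_ ur]|[s _ ->]]; last first.
    by split=> // w _; rewrite B_Zl vr mulr0.
  have [s Es] := sqr_onto_char2 (Q u / Q v) two0; exists s => //.
  apply/eqP; rewrite -subr_eq0; apply: contraT => uv0.
  have := H _ uv0; rewrite -scaleNr => /(_ _)/negP[].
    by move=> w; rewrite B_Dl B_Zl vr ur ?inE // mulr0 addr0.
  rewrite Q_line ur ?inE // mulr0 addr0 sqrrN Es divfK //.
  by rewrite -mulr2n -mulr_natl two0 mul0r.
rewrite card_imset => [|s r /eqP]; last first.
  by rewrite -subr_eq0 -scalerBl scaler_eq0 (negPf v0) orbF subr_eq0 => /eqP.
by rewrite -expnS => /eqP; rewrite eqn_exp2l // => /eqP; lia.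
Qed.

(** * Vectors with a prescribed value of [Q] and a prescribed product with a fixed vector *)

Definition slice v t b := #|[set u | (B u v == t) && (Q u == b)]|.
Arguments slice v t%_R b%_R.

(** The new parameters are the coefficients of [Q v * X ^+ 2 + t * X + b] taken at [X + s]. *)
Lemma slice_shift v t b s :
  slice v t b = slice v (t + 2 * Q v * s) (b + s * t + s ^+ 2 * Q v).
Proof.
apply: (@eq_card_bij _ _ (fun u => u + s *: v) (fun u => u + (- s) *: v)).
- by move=> u; rewrite -addrA -scalerDl subrr scale0r addr0.
- by move=> u; rewrite -addrA -scalerDl addNr scale0r addr0.
move=> u; rewrite !inE B_line Q_line (inj_eq (addIr _)).
by case: eqP => //= ->; rewrite (inj_eq (addIr _)) (inj_eq (addIr _)).
Qed.

(** On the polynomial side this multiplies the roots by [a]. *)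
Lemma slice_scale v t b a : a != 0 -> slice v t b = slice v (a * t) (a ^+ 2 * b).
Proof.
move=> a0; apply: (@eq_card_bij _ _ (fun u => a *: u) (fun u => a^-1 *: u)).
- by move=> u; rewrite scalerA mulVf // scale1r.
- by move=> u; rewrite scalerA divff // scale1r.
move=> u; rewrite !inE B_Zl Q_scale (inj_eq (mulfI a0)).
by rewrite (inj_eq (mulfI (expf_neq0 2 a0))).
Qed.

Hypothesis ndV : nondegenerate [set: V].
Variable k : nat.
Hypothesis cardV : #|V| = (#|F| ^ (2 * k).+2)%N.
Local Notation W := (#|F| ^ (2 * k))%N.
Local Notation M0 := (count_on [set: V] 0).

Let q1 : (1 < #|F|)%N. Proof. exact: card_finNzRing_gt1. Qed.

Lemma exists_polar_neq0 v : v != 0 -> exists u, B u v != 0.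
Proof.
move=> v0; apply/existsP; apply: contraNT v0 => /existsPn/= Bz.
apply/eqP/ndV; rewrite ?inE // => w _.
by apply/eqP; rewrite B_C; have := Bz w; rewrite negbK.
Qed.

Lemma sum_slice v t : v != 0 -> (\sum_b slice v t b = W * #|F|)%N.
Proof.
move=> /exists_polar_neq0[u0 u0v].
have := card_polar_fiber t subspaceT (in_setT u0) u0v.
rewrite cardsT cardV -[(2 * k).+2]/(1 + (2 * k).+1)%N expnD mulnC expn1.
move/eqP; rewrite eqn_pmul2l ?(ltnW q1) // expnSr => /eqP <-.
rewrite (card_fibers Q); apply: eq_bigr => b _.
by apply: eq_card => u; rewrite !inE.
Qed.

(** Used with [b = 0] to bring in [M0], and for isotropic [v] to determine the slice at [t = 0] from
    the others. *)
Lemma count_on_slice v b : (count_on [set: V] b = \sum_t slice v t b)%N.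
Proof.
rewrite /count_on (card_fibers (B^~ v)); apply: eq_bigr => t _.
by apply: eq_card => u; rewrite !inE andbC.
Qed.

(** Shifting along an isotropic [v] fixes [t] and moves [b] by [s * t], so all [b] are equally
    frequent. *)
Lemma slice_isotropic v t b : v != 0 -> Q v = 0 -> t != 0 -> slice v t b = W.
Proof.
move=> v0 Qv t0; have E c : slice v t c = slice v t b.
  rewrite (slice_shift _ _ c ((b - c) / t)) Qv !(mulr0, mul0r, addr0) divfK //.
  by rewrite addrC subrK.
have := sum_slice t v0; rewrite (eq_bigr _ (fun c _ => E c)) sum_nat_const.
by rewrite mulnC => /eqP; rewrite eqn_pmul2r ?(ltnW q1) // => /eqP.
Qed.

Lemma slice_isotropic0 v b : v != 0 -> Q v = 0 ->
  (slice v 0 b + (#|F| - 1) * W = count_on [set: V] b)%N.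
Proof.
move=> v0 Qv; rewrite (count_on_slice v) (bigD1 0) //=; congr addn.
rewrite (eq_bigr (fun _ => W)) => [|t t0]; last exact: slice_isotropic.
rewrite sum_nat_const; congr muln; rewrite subn1 -(cardC1 (0 : F)).
by apply: eq_card => t; rewrite !inE.
Qed.

(** In characteristic 2, shifts along [v] keep [t = 0] and reach every [b], so these slices are all
    equal. In odd characteristic, split off [w] from the complement of [v]: [- Q w * s ^+ 2] is 0
    only for [s = 0], and nonzero values count alike on [U2] by [count_on_even], so the sum over [s]
    equals the sum over all values, which is [#|U2|]. *)
Lemma slice00 v : Q v != 0 -> slice v 0 0 = W.
Proof.
move=> Qv; have v0 : v != 0 by apply: contraNneq Qv => ->; rewrite Q_0.
have [two0|two0] := eqVneq (2 : F) 0.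
  have E b : slice v 0 b = slice v 0 0.
    have [s Es] := sqr_onto_char2 (b / Q v) two0.
    by rewrite [RHS](slice_shift _ _ _ s) two0 Es divfK // !mul0r !add0r mulr0 add0r.
  have := sum_slice 0 v0; rewrite (eq_bigr _ (fun c _ => E c)) sum_nat_const.
  by rewrite mulnC => /eqP; rewrite eqn_pmul2r ?(ltnW q1) // => /eqP.
have sV := subspaceT; have Vv := in_setT v.
have Bvv : B v v != 0 by rewrite B_vv mulf_neq0.
have cU := card_perp sV Vv Bvv; rewrite cardsT cardV in cU.
have sU := perp_subspace v sV; have ndU := perp_nondegenerate two0 sV ndV Vv Qv.
set U := perp _ v in cU sU ndU.
have cU' : #|U| = (#|F| ^ (2 * k).+1)%N.
  by apply/eqP; rewrite -(eqn_pmul2r (ltnW q1)) cU -expnSr.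
have c1 : (1 < #|U|)%N by rewrite cU' -(expn0 #|F|) ltn_exp2l.
have [w Uw Qw] := exists_anisotropic sU ndU c1.
have Bww : B w w != 0 by rewrite B_vv mulf_neq0.
have cU2 := card_perp sU Uw Bww.
have sU2 := perp_subspace w sU; have ndU2 := perp_nondegenerate two0 sU ndU Uw Qw.
set U2 := perp _ w in cU2 sU2 ndU2.
have cU2' : #|U2| = W.
  by apply/eqP; rewrite -(eqn_pmul2r (ltnW q1)) cU2 cU' -expnSr.
have -> : slice v 0 0 = count_on U 0.
  by apply: eq_card => u; rewrite !inE.
rewrite (count_on_split two0 _ sU Uw Qw) -cU2' (card_fibers Q).
have E b : b != 0 -> count_on U2 b = count_on U2 1.
  move=> b0; exact: (count_on_even two0 sU2 ndU2 cU2' b0 (oner_neq0 _)).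
rewrite (bigD1 0) //= [RHS](bigD1 0) //=; congr addn.
  by rewrite expr0n mulr0 subr0.
by apply: eq_bigr => s s0; rewrite sub0r [RHS]E // E // oppr_eq0 mulf_neq0 ?expf_neq0.
Qed.

(** Translating by the root [s] makes the constant term 0; the remaining linear coefficient is
    either 0 or scaled to 1. *)
Lemma slice_rooted v t b s : Q v != 0 -> s \in quad_roots (Q v) t b ->
  slice v t b = if t + 2 * Q v * s == 0 then W else slice v 1 0.
Proof.
move=> Qv; rewrite inE => /eqP Es.
have -> : slice v t b = slice v (t + 2 * Q v * s) 0.
  by rewrite -Es (slice_shift _ _ _ s); congr slice; ring.
case: eqP => [->|/eqP t0]; first exact: slice00.
by rewrite (slice_scale _ _ _ (invr_neq0 t0)) mulVf // mulr0.
Qed.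

(** Sort the zeros of [Q] by their product with [v]; nonzero products are scaled to 1. *)
Lemma slice10 v : Q v != 0 -> (W + (#|F| - 1) * slice v 1 0 = M0)%N.
Proof.
move=> Qv; rewrite (count_on_slice v) (bigD1 0) //= slice00 //; congr addn.
rewrite (eq_bigr (fun _ => slice v 1 0)) => [|t t0]; last first.
  by rewrite (slice_scale _ _ _ (invr_neq0 t0)) mulVf // mulr0.
rewrite sum_nat_const; congr muln; rewrite subn1 -(cardC1 (0 : F)).
by apply: eq_card => t; rewrite !inE.
Qed.

(** Where a root exists, the deviation [del] vanishes by [slice_rooted]. At all rootless constant
    terms it has one common value, by [rootless_equiv]. Its total is 0, as slices and root counts
    have averages [W] and 1, so the common value is 0 as well. *)
Lemma slice_roots v t b : Q v != 0 ->
  (slice v t b)%:Z - W%:Z =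
    (#|quad_roots (Q v) t b|%:Z - 1) * ((slice v 1 0)%:Z - W%:Z).
Proof.
move=> Qv; have v0 : v != 0 by apply: contraNneq Qv => ->; rewrite Q_0.
pose del b := (slice v t b)%:Z - W%:Z -
  (#|quad_roots (Q v) t b|%:Z - 1) * ((slice v 1 0)%:Z - W%:Z).
suff : del b = 0 by move/eqP; rewrite subr_eq0 => /eqP.
have rooted c : quad_roots (Q v) t c != set0 -> del c = 0.
  case/set0Pn => s rs; rewrite /del (card_quad_roots Qv rs) (slice_rooted Qv rs).
  by case: eqP => _ /=; ring.
have [r0|/rooted//] := eqVneq (quad_roots (Q v) t b) set0.
have const c : quad_roots (Q v) t c = set0 -> del c = del b.
  move=> rc; rewrite /del r0 rc; congr (Posz _ - _ - _).
  have [a [s [a0 tE ->]]] := rootless_equiv Qv rc r0.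
  rewrite {1}(slice_scale _ _ _ a0) (slice_shift _ _ _ s) -tE; congr slice.
have : \sum_c del c = 0.
  have sumZ (g : F -> nat) : \sum_c (g c)%:Z = (\sum_c g c)%N%:Z.
    by rewrite (big_morph Posz PoszD erefl).
  have sumC (x : int) : \sum_(c : F) x = x * #|F|%:Z.
    by rewrite sumr_const -mulr_natr natz.
  rewrite sumrB -big_distrl /= !sumrB !sumC !sumZ sum_quad_roots sum_slice //.
  by rewrite PoszM; ring.
pose S := [set c | quad_roots (Q v) t c == set0].
rewrite (bigID (mem S)) /= addrC big1 => [|c]; last by rewrite inE => /rooted.
rewrite add0r (eq_bigr (fun _ => del b)) => [|c]; last by rewrite inE => /eqP/const.
rewrite sumr_const -mulr_natr => /eqP; rewrite mulf_eq0 => /orP[/eqP//|].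
rewrite pnatr_eq0 -leqn0 leqNgt; case/negP; apply/card_gt0P.
by exists b; rewrite inE r0.
Qed.

(** The factor [#|F| - 1] lets [slice10] replace [slice v 1 0] by [M0]; the right side then involves
    [v] only through [Q v]. *)
Lemma slice_formula v t b : Q v != 0 ->
  (#|F|%:Z - 1) * ((slice v t b)%:Z - W%:Z) =
    (#|quad_roots (Q v) t b|%:Z - 1) * (M0%:Z - #|F|%:Z * W%:Z).
Proof.
move=> Qv; rewrite slice_roots // mulrCA; congr (_ * _).
rewrite -(slice10 Qv) PoszD PoszM -subzn ?(ltnW q1) //; ring.
Qed.

(** * Intersection counts of level sets *)

Definition meet_count v (X Y : {set F}) :=
  #|[set u | (Q (v - u) \in X) && (Q u \in Y)]|.

(** The values [a] of [Q (v - u)] and [b] of [Q u] determine [B u v = Q v + b - a]. *)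
Lemma meet_countE v X Y :
  meet_count v X Y = (\sum_(a in X) \sum_(b in Y) slice v (Q v + b - a) b)%N.
Proof.
rewrite /meet_count -sum1_card (partition_big (fun u => Q (v - u)) (mem X)) /=; last first.
  by move=> u; rewrite inE => /andP[].
apply: eq_bigr => a Xa; rewrite (partition_big Q (mem Y)) /=; last first.
  by move=> u; rewrite inE => /andP[/andP[]].
apply: eq_bigr => b Yb; rewrite /slice -sum1_card; apply: eq_bigl => u.
rewrite !inE; case: (Q u =P b) => [Eu|]; last by rewrite !andbF.
rewrite quadratic_sub Eu Yb !andbT andb_idl; last by move/eqP->.
by rewrite -[RHS]subr_eq0 -subr_eq0 -oppr_eq0; congr (_ == 0); ring.
Qed.

Lemma meet_count_isotropic v v' X Y : v != 0 -> v' != 0 -> Q v = 0 -> Q v' = 0 ->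
  meet_count v X Y = meet_count v' X Y.
Proof.
move=> v0 v'0 Qv Qv'; rewrite !meet_countE Qv Qv'.
apply: eq_bigr => a _; apply: eq_bigr => b _.
have [->|t0] := eqVneq (0 + b - a) 0; last by rewrite !slice_isotropic.
by apply/eqP; rewrite -(eqn_add2r ((#|F| - 1) * W)%N) !slice_isotropic0.
Qed.

(** The quantity by which different quadratic spaces over [F] are compared: it does not refer to any
    space. *)
Definition root_count c (X Y : {set F}) :=
  (\sum_(a in X) \sum_(b in Y) #|quad_roots c (c + b - a) b|)%N.

Lemma meet_count_anisotropic v X Y : Q v != 0 ->
  (#|F|%:Z - 1) * (meet_count v X Y)%:Z =
    ((root_count (Q v) X Y)%:Z - (#|X| * #|Y|)%N%:Z) * (M0%:Z - #|F|%:Z * W%:Z) +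
    (#|X| * #|Y|)%N%:Z * ((#|F|%:Z - 1) * W%:Z).
Proof.
move=> Qv; rewrite meet_countE /root_count.
have sumZ (Z : {set F}) (g : F -> nat) : (\sum_(c in Z) g c)%N%:Z = \sum_(c in Z) (g c)%:Z.
  by rewrite (big_morph Posz PoszD erefl).
have CE : (#|X| * #|Y|)%N%:Z = \sum_(a in X) \sum_(b in Y) 1.
  by rewrite !sumr_const -mulrnA mulnC natz.
rewrite CE !sumZ -sumrB !mulr_suml mulr_sumr -big_split /=; apply: eq_bigr => a _.
rewrite !sumZ -sumrB !mulr_suml mulr_sumr -big_split /=; apply: eq_bigr => b _.
by rewrite -slice_formula //; ring.
Qed.

End QuadraticSpace.

(* Both counts are affine functions of the same number [root_count (Q v) X Y]. *)
Lemma meet_count_transfer (F : finFieldType) (V V' : finLmodType F)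
    (Q : V -> F) (Q' : V' -> F) (k k' : nat) (X Y : {set F}) (v w : V) (v' w' : V') :
    quadratic_map Q -> nondegenerate Q [set: V] -> #|V| = (#|F| ^ (2 * k).+2)%N ->
    quadratic_map Q' -> nondegenerate Q' [set: V'] -> #|V'| = (#|F| ^ (2 * k').+2)%N ->
    count_on Q' [set: V'] 0 <> (#|F| * #|F| ^ (2 * k'))%N ->
    Q v != 0 -> Q w != 0 -> Q' v' = Q v -> Q' w' = Q w ->
  meet_count Q' v' X Y = meet_count Q' w' X Y ->
  meet_count Q v X Y = meet_count Q w X Y.
Proof.
move=> qQ nQ cV qQ' nQ' cV' M0' Qv Qw Ev Ew E.
have q1 : #|F|%:Z - 1 != 0.
  by rewrite subr_eq0 eqz_nat neq_ltn card_finNzRing_gt1 orbT.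
have rE : root_count (Q v) X Y = root_count (Q w) X Y.
  have := meet_count_anisotropic qQ' nQ' cV' X Y (_ : Q' v' != 0); rewrite Ev => /(_ Qv).
  have := meet_count_anisotropic qQ' nQ' cV' X Y (_ : Q' w' != 0); rewrite Ew => /(_ Qw).
  rewrite E => -> /addIr/mulIf H.
  (* The slope of the affine function for [Q'] is nonzero, so [root_count] can be recovered from the
     count on [V']. *)
  have/H/addIr[//] : (count_on Q' [set: V'] 0)%:Z - #|F|%:Z * (#|F| ^ (2 * k'))%N%:Z != 0.
  by rewrite subr_eq0 -PoszM eqz_nat; apply/eqP.
have [] : Posz (meet_count Q v X Y) = Posz (meet_count Q w X Y); last by [].
apply: (mulfI q1).
by rewrite (meet_count_anisotropic qQ nQ cV) // (meet_count_anisotropic qQ nQ cV) // rE.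
Qed.

(** * Nonsingular forms in coordinates *)

Lemma quadratic_form_mx (F : fieldType) n (A : 'M[F]_n) (x : 'rV_n) :
  \sum_i \sum_j A i j * x 0 i * x 0 j = (x *m A *m x^T) 0 0.
Proof.
rewrite mxE exchange_big /=; apply: eq_bigr => j _; rewrite !mxE big_distrl /=.
by apply: eq_bigr => i _; rewrite [A i j * _]mulrC.
Qed.

Lemma quadratic_form_map (F : finFieldType) n (Q : 'rV[F]_n -> F) :
  quadratic_form Q -> quadratic_map (Q : ('rV[F]_n : finLmodType F) -> F).
Proof.
case=> A QE; have {}QE x : Q x = (x *m A *m x^T) 0 0 by rewrite QE quadratic_form_mx.
have tZ a (x : 'rV_n) : (a *: x)^T = a *: x^T by apply/matrixP => i j; rewrite !mxE.
have tD (x y : 'rV_n) : (x + y)^T = x^T + y^T by apply/matrixP => i j; rewrite !mxE.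
have mxD (M N : 'M[F]_1) : (M + N) 0 0 = M 0 0 + N 0 0 by rewrite mxE.
have mxZ a (M : 'M[F]_1) : (a *: M) 0 0 = a * M 0 0 by rewrite mxE.
split=> [a v|a u u' v].
  by rewrite !QE tZ -!scalemxAl -scalemxAr !mxZ expr2 mulrA.
have BE (x y : 'rV_n) : polar (Q : ('rV[F]_n : finLmodType F) -> F) x y =
    (x *m A *m y^T + y *m A *m x^T) 0 0.
  by rewrite /polar !QE tD !mulmxDl !mulmxDr !mxD; ring.
rewrite !BE tD tZ !mulmxDl !mulmxDr -!scalemxAl -!scalemxAr.
by rewrite !(mxD, mxZ); ring.
Qed.

(** Completes [v], up to a scalar, to a basis. It is placed last because [nonsingular] keeps the
    first variables. *)
Lemma unit_last_row (F : fieldType) n (v : 'rV[F]_n.+1) : v != 0 ->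
  exists2 P : 'M_n.+1, P \in unitmx & exists2 c, c != 0 & v = c *: row ord_max P.
Proof.
move=> v0; pose P := xrow 0 ord_max (row_ebase v).
exists P; first by rewrite /P xrowE unitmx_mul unitmx_perm row_ebase_unit.
have rv : \rank v = 1%N by rewrite rank_rV v0.
have -> : row ord_max P = row 0 (row_ebase v).
  by apply/rowP => j; rewrite !mxE tpermR.
have vE : v = col_ebase v 0 0 *: row 0 (row_ebase v).
  rewrite -[LHS]mulmx_ebase rv [col_ebase v]mx11_scalar mul_scalar_mx -scalemxAl mxE mulr1n.
  congr (_ *: _); rewrite rowE; congr (_ *m _).
  by apply/matrixP => i j; rewrite !mxE !ord1 eqxx andbT eq_sym.
exists (col_ebase v 0 0) => //.
by apply: contraNneq v0 => c0; rewrite vE c0 scale0r.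
Qed.

(** [Q] is invariant under translation by a radical vector on which it vanishes; with that vector as
    last basis vector, the last variable drops out. *)
Lemma nonsingular_radical (F : finFieldType) n (Q : 'rV[F]_n -> F) :
    quadratic_form Q -> nonsingular Q -> forall v, v != 0 ->
    (forall w, polar (Q : ('rV[F]_n : finLmodType F) -> F) v w = 0) -> Q v != 0.
Proof.
move=> Qf ns v v0 vr; apply/negP => /eqP Qv; apply: ns.
have [Qs Ql] := quadratic_form_map Qf.
case: n => [|n] in Q Qf v v0 vr Qv Qs Ql *; first by rewrite thinmx0 eqxx in v0.
have [P Pu [c c0 vE]] := unit_last_row v0; set r := row _ P in vE.
have Qr : Q r = 0.
  by move/eqP: Qv; rewrite vE Qs mulf_eq0 expf_eq0 (negPf c0) /= => /eqP.
have Q0 : Q 0 = 0 by rewrite -(scale0r (0 : 'rV_n.+1)) Qs expr0n mul0r.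
have B0 (w : 'rV_n.+1) : polar (Q : ('rV[F]_n.+1 : finLmodType F) -> F) 0 w = 0.
  by rewrite /polar add0r Q0 subr0 subrr.
have Br (w : 'rV_n.+1) : polar (Q : ('rV[F]_n.+1 : finLmodType F) -> F) r w = 0.
  move/eqP: (vr w); have := Ql c r 0 w; rewrite addr0 -vE => ->.
  by rewrite B0 addr0 mulf_eq0 (negPf c0) => /eqP.
have shift a (w : 'rV_n.+1) : Q (a *: r + w) = Q w.
  have /eqP := Ql a r 0 w; rewrite addr0 Br B0 mulr0 addr0 /polar Qs Qr mulr0 subr0.
  by rewrite subr_eq0 => /eqP.
case: Qf => A QE; pose C := P *m A *m P^T.
pose wd := widen_ord (ltnW (ltnSn n)).
exists n, (ltnSn n), P, (fun y => \sum_i \sum_j C (wd i) (wd j) * y 0 i * y 0 j).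
split=> //.
  exists (\matrix_(i, j) C (wd i) (wd j)) => x /=.
  by apply: eq_bigr => i _; apply: eq_bigr => j _; rewrite mxE.
(* [x'] is [x] with its last coordinate set to 0. *)
move=> x; pose x' := x - x 0 ord_max *: delta_mx 0 ord_max.
have -> : Q (x *m P) = Q (x' *m P).
  have -> : x *m P = x 0 ord_max *: r + x' *m P.
    by rewrite /x' /r rowE mulmxBl -scalemxAl addrC subrK.
  exact: shift.
have -> : Q (x' *m P) = \sum_i \sum_j C i j * x' 0 i * x' 0 j.
  by rewrite QE !quadratic_form_mx trmx_mul !mulmxA.
have x'm : x' 0 ord_max = 0 by rewrite !mxE !eqxx mulr1 subrr.
have x'w i : x' 0 (widen_ord (leqnSn n) i) = x 0 (wd i).
  have -> : x' 0 (widen_ord (leqnSn n) i) = x 0 (widen_ord (leqnSn n) i).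
    have /negPf ne : widen_ord (leqnSn n) i != ord_max.
      by rewrite neq_ltn /= ltn_ord.
    by rewrite !mxE ne andbF mulr0 subr0.
  by congr (x _ _); apply: val_inj.
clearbody C x'.
rewrite big_ord_recr /= [X in _ + X]big1 ?addr0; last first.
  by move=> j _; rewrite x'm mulr0 mul0r.
apply: eq_bigr => i _; rewrite big_ord_recr /= x'm mulr0 addr0.
apply: eq_bigr => j _; rewrite !mxE !x'w.
by congr (C _ _ * _ * _); apply: val_inj.
Qed.

(** * The norm form and cyclotomic classes *)

(** A copy of [K] that carries [iota] in its type, so that its [F]-module structure can be attached
    to it. *)
Definition restricted (F K : finFieldType) of {rmorphism F -> K} : Type := K.

Section RestrictionOfScalars.
Variables (F K : finFieldType) (iota : {rmorphism F -> K}).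

HB.instance Definition _ := Finite.copy (restricted iota) K.
HB.instance Definition _ := GRing.Zmodule.copy (restricted iota) K.

Let scale (a : F) (z : restricted iota) : restricted iota := iota a * (z : K).

Let scaleA a b v : scale a (scale b v) = scale (a * b) v.
Proof. by rewrite /scale rmorphM mulrA. Qed.

Let scale1 : left_id 1 scale.
Proof. by move=> v; rewrite /scale rmorph1 mul1r. Qed.

Let scaleDr : right_distributive scale +%R.
Proof. by move=> a u v; rewrite /scale mulrDr. Qed.

Let scaleDl v : {morph scale^~ v : a b / a + b}.
Proof. by move=> a b; rewrite /scale rmorphD mulrDl. Qed.

HB.instance Definition _ :=
  GRing.Zmodule_isLmodule.Build F (restricted iota) scaleA scale1 scaleDr scaleDl.

Lemma restricted_scaleE (a : F) (z : restricted iota) :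
  a *: z = iota a * (z : K) :> K.
Proof. by []. Qed.

End RestrictionOfScalars.

(** Exponents of [g] matter modulo [#|L| - 1], a multiple of [e], so their residues modulo [e] are
    well defined. *)
Lemma mem_cyclo_class (L : finFieldType) (g : L) (e i j : nat) :
    (#|L| - 1).-primitive_root g -> (e %| #|L| - 1)%N -> (i < e)%N ->
  (g ^+ j \in cyclo_class g e i) = (j == i %[mod e]).
Proof.
move=> pg ed ie; have L0 : (0 < #|L| - 1)%N by exact: prim_order_gt0 pg.
have modE x y : x = y %[mod #|L| - 1] -> x = y %[mod e].
  by move=> xy; rewrite -(modn_dvdm x ed) xy modn_dvdm.
apply/imsetP/eqP => [[t _]|ji].
  rewrite -exprM -exprD => /eqP; rewrite (eq_prim_root_expr pg) => /eqP/modE ->.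
  by rewrite addnC mulnC modnMDl.
have lt : (j %% (#|L| - 1) %/ e < #|L|)%N.
  apply: leq_ltn_trans (leq_div _ _) _.
  by apply: leq_trans (ltn_pmod _ L0) _; rewrite leq_subr.
exists (Ordinal lt) => //=; rewrite -exprM -exprD -[LHS](prim_expr_mod pg).
congr (g ^+ _); rewrite {1}(divn_eq (j %% (#|L| - 1)) e) modn_dvdm // ji.
by rewrite (modn_small ie) addnC mulnC.
Qed.

Section NormForm.
Variables (F K : finFieldType) (iota : {rmorphism F -> K}).
Hypothesis cardK : #|K| = (#|F| ^ 2)%N.
Variables (p f : nat) (gamma : K) (omega : F).
Hypotheses (p_prime : prime p) (cardF : #|F| = (p ^ f)%N).
Hypothesis gamma_prim : (#|F| ^ 2 - 1).-primitive_root gamma.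
Hypothesis omega_def : iota omega = gamma ^+ (#|F| + 1).

Let gamma_primK : (#|K| - 1).-primitive_root gamma.
Proof. by rewrite cardK. Qed.

(** The power [gamma ^+ (q + 1)] has order [(q ^ 2 - 1) / (q + 1) = q - 1], where [q = #|F|]. *)
Lemma omega_prim : (#|F| - 1).-primitive_root omega.
Proof.
have E : (#|F| ^ 2 - 1 = (#|F| - 1) * (#|F| + 1))%N by rewrite -(exp1n 2) subn_sqr exp1n.
have d : (#|F| - 1 %| #|F| ^ 2 - 1)%N by rewrite E dvdn_mulr.
have F1 : (0 < #|F| - 1)%N by rewrite subn_gt0 card_finNzRing_gt1.
have := dvdn_prim_root gamma_prim d.
by rewrite E mulKn // -omega_def fmorph_primitive_root.
Qed.

Lemma nonzero_power (L : finFieldType) (g x : L) :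
  (#|L| - 1).-primitive_root g -> x != 0 -> exists j, x = g ^+ j.
Proof.
move=> pg x0; have [|i ->] := prim_rootP pg (x := x); last by exists i.
by apply: (mulfI x0); rewrite mulr1 -exprS subn1 prednK ?expf_card ?(ltnW (card_finNzRing_gt1 _)).
Qed.

(** The norm [z ^+ (q + 1)] pulled back along [iota]; [norm_formE] shows that a preimage always
    exists, so the default is harmless. *)
Definition norm_form (z : restricted iota) : F :=
  odflt 0 [pick a | iota a == (z : K) ^+ (#|F| + 1)].

Lemma norm_formE z : iota (norm_form z) = (z : K) ^+ (#|F| + 1).
Proof.
rewrite /norm_form; case: pickP => [a /eqP//|no].
have [z0|z0] := eqVneq (z : K) 0.
  by have := no 0; rewrite z0 rmorph0 addn1 expr0n eqxx.
have [j zE] := nonzero_power gamma_primK z0.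
by have := no (omega ^+ j); rewrite rmorphXn /= omega_def zE -!exprM mulnC eqxx.
Qed.

Lemma norm_form_gamma j : norm_form (gamma ^+ j) = omega ^+ j.
Proof.
by apply: (fmorph_inj iota); rewrite norm_formE rmorphXn /= omega_def -!exprM mulnC.
Qed.

Lemma norm_form_eq0 z : (norm_form z == 0) = (z == 0).
Proof. by rewrite -(fmorph_eq0 iota) norm_formE expf_eq0 addn1. Qed.

Let charK_nat : [pchar K].-nat #|F|.
Proof.
have pK : p \in [pchar K] by rewrite (fmorph_pchar iota) (card_finPcharP cardF).
by rewrite (eq_pnat _ (pcharf_eq pK)) cardF pnatX pnat_id.
Qed.

(** The polar form is the trace of [u ^+ q * v], since the [q]-th power is additive. *)
Lemma norm_form_polar u v :
  iota (polar norm_form u v) = (u : K) ^+ #|F| * v + (u : K) * (v : K) ^+ #|F|.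
Proof.
rewrite /polar !rmorphB /= !norm_formE !addn1 !exprSr exprDn_pchar //; ring.
Qed.

Lemma norm_form_quadratic : quadratic_map norm_form.
Proof.
have iq (a : F) : iota a ^+ #|F| = iota a by rewrite -rmorphXn /= expf_card.
split=> [a z|a u u' v]; apply: (fmorph_inj iota).
  rewrite rmorphM /= !norm_formE restricted_scaleE exprMn; congr (_ * _).
  by rewrite addn1 exprS iq rmorphXn.
rewrite [LHS]norm_form_polar [RHS]rmorphD [in RHS]rmorphM /= !norm_form_polar.
rewrite exprDn_pchar ?charK_nat // restricted_scaleE exprMn iq; ring.
Qed.

(** Pairing a nonzero radical [u] with [u * r] gives [r ^+ q = - r] for all [r]. Taking [r = 1]
    yields [-1 = 1], and then [r = gamma] yields [gamma ^+ (q - 1) = 1], against the order of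
    [gamma]. *)
Lemma norm_form_nondegenerate : nondegenerate norm_form [set: restricted iota].
Proof.
move=> u _ ur; apply/eqP; apply: contraT => u0.
have E (r : K) : r ^+ #|F| = - r.
  have := ur ((u : K) * r) (in_setT _); move/(congr1 iota).
  rewrite norm_form_polar rmorph0 exprMn => H.
  apply/eqP; rewrite -addr_eq0 -(inj_eq (mulfI (expf_neq0 #|F|.+1 u0))) mulr0 -H.
  by apply/eqP; rewrite exprS; ring.
have E1 : -1 = 1 :> K by rewrite -E expr1n.
have : gamma ^+ (#|F| - 1) == 1.
  have g0 : gamma != 0.
    apply: contra_eqN (prim_expr_order gamma_prim) => /eqP->.
    by rewrite expr0n (gtn_eqF (prim_order_gt0 gamma_prim)) eq_sym oner_neq0.
  rewrite -(inj_eq (mulfI g0)) mulr1 -exprS subn1 prednK ?(ltnW (card_finNzRing_gt1 _)) //.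
  by rewrite E -mulN1r E1 mul1r.
rewrite -(prim_order_dvd gamma_prim); have q1 := card_finNzRing_gt1 F.
by move/dvdn_leq; move: q1; rewrite subn_gt0 expnS expn1; move: #|F| => x x1 /(_ x1); nia.
Qed.

End NormForm.

(** * Schemes of Cayley graphs *)

Lemma fam_cons_0 (T : Type) d (x : T) (g : 'I_d -> T) : fam_cons x g ord0 = x.
Proof. by rewrite /fam_cons unlift_none. Qed.

Lemma fam_cons_lift (T : Type) d (x : T) (g : 'I_d -> T) i :
  fam_cons x g (lift ord0 i) = g i.
Proof. by rewrite /fam_cons liftK. Qed.

Definition conv_count (G : finZmodType) (D E : {set G}) v :=
  #|[set u | (v - u \in D) && (u \in E)]|.

Lemma card_Cay_triangle (G : finZmodType) (D E : {set G}) x y :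
  #|[set z | ((x, z) \in Cay D) && ((z, y) \in Cay E)]| = conv_count D E (x - y).
Proof.
apply: (@eq_card_bij _ _ (fun z => z - y) (fun u => u + y)).
- by move=> z; rewrite subrK.
- by move=> z; rewrite addrK.
by move=> z; rewrite !inE /= opprB addrA subrK.
Qed.

Lemma association_scheme_Cay (G : finZmodType) d (R : 'I_d.+1 -> {set G * G})
    (D : 'I_d.+1 -> {set G}) :
    (forall i, R i = Cay (D i)) -> D ord0 = [set 0] ->
    (forall v, exists! i, v \in D i) ->
    (forall i v, v \in D i -> - v \in D i) ->
    (forall i j k v w, v \in D k -> w \in D k ->
       conv_count (D i) (D j) v = conv_count (D i) (D j) w) ->
  association_scheme R.
Proof.
move=> RD D0 Du DN Dc; split.
- by rewrite RD D0; apply/setP => xy; rewrite !inE subr_eq0.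
- move=> xy; have [i [Di iu]] := Du (xy.1 - xy.2); exists i.
  by split=> [|j]; rewrite RD inE //; apply: iu.
- by move=> i x y; rewrite RD !inE /= => /DN; rewrite opprB.
(* The number is read off at any representative of class [k]; the default 0 serves an empty class,
   where the condition is vacuous. *)
exists (fun i j k => if [pick v in D k] is Some v then conv_count (D i) (D j) v else 0%N).
move=> i j k x y; rewrite !RD inE /= card_Cay_triangle => Dxy.
by case: pickP => [v /= Dv|/(_ (x - y))]; [exact: Dc Dv | rewrite /= Dxy].
Qed.

Lemma conv_count_Cay (G : finZmodType) d (R : 'I_d.+1 -> {set G * G})
    (D : 'I_d.+1 -> {set G}) i j k v w :
    (forall i, R i = Cay (D i)) -> association_scheme R -> v \in D k -> w \in D k ->
  conv_count (D i) (D j) v = conv_count (D i) (D j) w.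
Proof.
move=> RD [_ _ _ [p pE]] Dv Dw.
have count u : u \in D k -> conv_count (D i) (D j) u = p i j k.
  move=> Du; rewrite -(pE i j k u 0) ?RD ?inE ?subr0 //.
  by rewrite card_Cay_triangle subr0.
by rewrite !count.
Qed.

(** * From level-set counts to the classes of the form scheme *)

Section Assembly.
Variables (F : finFieldType) (V : finLmodType F) (Q : V -> F) (d : nat).
Variable (Y : 'I_d.+1 -> {set F}).
Hypothesis Qq : quadratic_map Q.
Hypothesis Yu : forall c, exists! i, c \in Y i.

(** The zero vector has its own class, which shifts the indices by one; [v != 0] only affects the
    class whose [Y k] contains 0. *)
Definition form_class : 'I_d.+2 -> {set V} :=
  fam_cons [set 0] (fun k => [set v | (v != 0) && (Q v \in Y k)]).

Let Y_inj c i j : c \in Y i -> c \in Y j -> i = j.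
Proof. by move=> ci cj; have [k [_ kP]] := Yu c; rewrite -(kP i ci) (kP j cj). Qed.

Lemma form_class_unique v : exists! i, v \in form_class i.
Proof.
have [->|v0] := eqVneq v 0.
  exists ord0; split; first by rewrite /form_class fam_cons_0 inE.
  by move=> j; case: (unliftP ord0 j) => [i ->|->//]; rewrite /form_class fam_cons_lift inE eqxx.
have [k [vk ku]] := Yu (Q v); exists (lift ord0 k); split.
  by rewrite /form_class fam_cons_lift inE v0.
move=> j; case: (unliftP ord0 j) => [i ->|->]; rewrite /form_class.
  by rewrite fam_cons_lift inE => /andP[_ /ku ->].
by rewrite fam_cons_0 inE (negPf v0).
Qed.

(** The corrections are the solutions [u = 0] and [u = v], which the classes of nonzero vectors
    exclude. *)
Lemma conv_meet_count v i j : v != 0 ->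
  meet_count Q v (Y i) (Y j) =
    ((Q v \in Y i) && (0%R \in Y j) + ((0%R \in Y i) && (Q v \in Y j)) +
     conv_count (form_class (lift ord0 i)) (form_class (lift ord0 j)) v)%N.
Proof.
move=> v0; rewrite /meet_count /conv_count.
set S := [set u | _]; have Q0 : Q 0 = 0.
  by rewrite -(scale0r (0 : V)) (Qq.1) expr0n mul0r.
rewrite (cardsD1 0 S) (cardsD1 v (S :\ 0)) -addnA !inE v0 subr0 subrr Q0.
congr (_ + (_ + _))%N; apply: eq_card => u; rewrite /form_class !fam_cons_lift !inE.
by rewrite subr_eq0 [v == u]eq_sym; case: (u == v); case: (u == 0); rewrite ?andbF.
Qed.

(** Convolving with the zero class gives the indicator of the other class. Elsewhere the corrections
    in [conv_meet_count] depend only on the class of [v] and cancel. *)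
Lemma conv_count_form_class :
  (forall i j k v w, v != 0 -> w != 0 -> Q v \in Y k -> Q w \in Y k ->
     meet_count Q v (Y i) (Y j) = meet_count Q w (Y i) (Y j)) ->
  forall i j k v w, v \in form_class k -> w \in form_class k ->
    conv_count (form_class i) (form_class j) v =
    conv_count (form_class i) (form_class j) w.
Proof.
move=> meet i j k v w.
case: (unliftP ord0 k) => [l ->|->]; last first.
  by rewrite /form_class fam_cons_0 !inE => /eqP-> /eqP->.
move=> vk wk; have same h : (v \in form_class h) = (w \in form_class h).
  have [hv [Hv uv]] := form_class_unique v; have [hw [Hw uw]] := form_class_unique w.
  apply/idP/idP => H.
    by rewrite -(uv _ H) (uv _ vk).
  by rewrite -(uw _ H) (uw _ wk).
have conv0l h u : conv_count (form_class ord0) (form_class h) u = (u \in form_class h).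
  rewrite /conv_count {1}/form_class fam_cons_0.
  case: (boolP (u \in _)) => uh; [apply/eqP/cards1P; exists u | apply: eq_card0 => x].
    apply/setP => x; rewrite !inE subr_eq0 eq_sym.
    by case: eqP => // ->; rewrite uh.
  by rewrite !inE subr_eq0; apply: contraNF uh => /andP[/eqP->].
have conv0r h u : conv_count (form_class h) (form_class ord0) u = (u \in form_class h).
  rewrite /conv_count [form_class ord0]/form_class fam_cons_0.
  case: (boolP (u \in _)) => uh; [apply/eqP/cards1P; exists 0 | apply: eq_card0 => x].
    apply/setP => x; rewrite !inE andbC.
    by case: eqP => // ->; rewrite subr0 uh.
  by rewrite !inE; apply: contraNF uh => /andP[H /eqP x0]; rewrite x0 subr0 in H.
case: (unliftP ord0 i) => [i' ->|->]; last by rewrite !conv0l same.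
case: (unliftP ord0 j) => [j' ->|->]; last by rewrite !conv0r same.
move: vk wk; rewrite /form_class fam_cons_lift -/form_class !inE.
case/andP=> v0 Qv /andP[w0 Qw].
have sameY h : (Q v \in Y h) = (Q w \in Y h).
  by apply/idP/idP => H; [rewrite (Y_inj H Qv) | rewrite (Y_inj H Qw)].
have := meet i' j' l v w v0 w0 Qv Qw.
by rewrite !conv_meet_count // !sameY => /addnI.
Qed.

End Assembly.

(** * Unions of cyclotomic classes *)

Section CycloUnion.
Variables (L : finFieldType) (g : L) (e : nat).
Hypotheses (pg : (#|L| - 1).-primitive_root g) (ed : (e %| #|L| - 1)%N).

Let e_gt0 : (0 < e)%N.
Proof. exact: dvdn_gt0 (prim_order_gt0 pg) ed. Qed.

Lemma cyclo_union_expr (A : {set 'I_e}) (l : 'I_e) j : (j %% e)%N = l ->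
  (g ^+ j \in cyclo_union g A) = (l \in A).
Proof.
move=> jl; have E (h : 'I_e) : (g ^+ j \in cyclo_class g e h) = (h == l).
  by rewrite mem_cyclo_class // -val_eqE /= jl (modn_small (ltn_ord h)) eq_sym.
apply/bigcupP/idP => [[h Ah]|Al]; first by rewrite E => /eqP <-.
by exists l; rewrite // E.
Qed.

Lemma cyclo_union_neq0 (A : {set 'I_e}) : 0 \notin cyclo_union g A.
Proof.
have g0 : g != 0.
  apply: contra_eqN (prim_expr_order pg) => /eqP->.
  by rewrite expr0n (gtn_eqF (prim_order_gt0 pg)) eq_sym oner_neq0.
apply/bigcupP => -[l _ /imsetP[t _ /esym/eqP]].
by rewrite mulf_eq0 !expf_eq0 (negPf g0) !andbF.
Qed.

Lemma cyclo_union_unique d (A : 'I_d -> {set 'I_e}) (c : L) :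
  injective A -> partition [set A i | i : 'I_d] [set: 'I_e] -> c != 0 ->
  exists! i, c \in cyclo_union g (A i).
Proof.
move=> A_inj /and3P[/eqP cov tr _] /(nonzero_power pg)[j ->].
set l := Ordinal (ltn_pmod j e_gt0).
have : l \in cover [set A i | i : 'I_d] by rewrite cov inE.
have Aim i : A i \in [set A i | i : 'I_d] by apply/imsetP; exists i.
case/bigcupP => _ /imsetP[i _ ->] li; exists i.
split=> [|i']; rewrite (cyclo_union_expr _ (l := l)) // => li'; apply: A_inj.
by rewrite -(def_pblock tr (Aim i) li) -(def_pblock tr (Aim i') li').
Qed.

End CycloUnion.

(** * Transfer of the intersection numbers from the quadratic extension to [V] *)

Theorem theorem5p2 (p f q m n : nat) (F K : finFieldType)
    (iota : {rmorphism F -> K})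
    (p_prime : prime p) (f_gt0 : (0 < f)%N) (q_def : q = (p ^ f)%N)
    (cardF : #|F| = q) (cardK : #|K| = (q ^ 2)%N)
    (m_gt0 : (0 < m)%N) (n_def : n = (2 * m)%N)
    (Q : 'rV[F]_n -> F) (Q_quad : quadratic_form Q) (Q_ns : nonsingular Q)
    (e : nat) (e_dvd : (e %| q - 1)%N)
    (gamma : K) (gamma_prim : (q ^ 2 - 1).-primitive_root gamma)
    (omega : F) (omega_def : iota omega = gamma ^+ (q + 1))
    (d : nat) (A : 'I_d -> {set 'I_e})
    (A_inj : injective A)
    (A_part : partition [set A i | i : 'I_d] [set: 'I_e])
    (A_fusion : fusion_scheme (@cyclotomic_rel K gamma e)
       (graphs_rel (fun i : 'I_d => Cay (cyclo_union gamma (A i))))) :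
  association_scheme (graphs_rel (form_graphs Q omega A)) /\
  (forall k : 'I_d.+1, form_graphs Q omega A k = set0 ->
     k = ord0 /\ level_set Q [set 0] = [set 0]).
Proof.
rewrite -cardF in cardK e_dvd gamma_prim omega_def.
have cardF' : #|F| = (p ^ f)%N by rewrite cardF.
pose V : finLmodType F := 'rV[F]_n; pose QV : V -> F := Q.
have Qq : quadratic_map QV := quadratic_form_map Q_quad.
have [k nk] : exists k, n = (2 * k).+2 by exists m.-1; rewrite n_def; lia.
have cV : #|V| = (#|F| ^ (2 * k).+2)%N by rewrite card_mx mul1n nk.
have Qnd : nondegenerate QV [set: V].
  apply: (nondegenerate_even Qq (m := m)); first by rewrite card_mx mul1n n_def.
  exact: nonsingular_radical.
have po := omega_prim gamma_prim omega_def.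
have pgK : (#|K| - 1).-primitive_root gamma by rewrite cardK.
have edK : (e %| #|K| - 1)%N.
  by rewrite cardK -{2}(exp1n 2) subn_sqr dvdn_mulr.
pose N : restricted iota -> F := norm_form (iota := iota).
have Nq : quadratic_map N := norm_form_quadratic cardK p_prime cardF' gamma_prim omega_def.
have Nnd : nondegenerate N [set: restricted iota] :=
  norm_form_nondegenerate cardK p_prime cardF' gamma_prim omega_def.
have N0 z : (N z == 0) = (z == 0) := norm_form_eq0 cardK gamma_prim omega_def z.
(* One partition of the values in [F] serves both the norm [N] and the form [QV]. *)
pose Y : 'I_d.+1 -> {set F} := fam_cons [set 0] (fun i => cyclo_union omega (A i)).
have Y0 : Y ord0 = [set 0] by rewrite /Y fam_cons_0.
have Yl i : Y (lift ord0 i) = cyclo_union omega (A i) by rewrite /Y fam_cons_lift.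
have Yu c : exists! i, c \in Y i.
  have [->|c0] := eqVneq c 0.
    exists ord0; split=> [|j]; first by rewrite Y0 inE.
    by case: (unliftP ord0 j) => [i ->|->//]; rewrite Yl (negPf (cyclo_union_neq0 po _)).
  have [i [ci iu]] := cyclo_union_unique po e_dvd A_inj A_part c0.
  exists (lift ord0 i); split=> [|j]; first by rewrite Yl.
  case: (unliftP ord0 j) => [h ->|->]; first by rewrite Yl => /iu->.
  by rewrite Y0 inE (negPf c0).
(* The norm sends [gamma ^+ j] to [omega ^+ j], so exponents agree modulo [e]. *)
have NY z (i : 'I_d) : (N z \in cyclo_union omega (A i)) = (z \in cyclo_union gamma (A i)).
  have [->|z0] := eqVneq z 0.
    have /eqP-> : N 0 == 0 by rewrite N0.
    by rewrite !(negPf (cyclo_union_neq0 _ _)).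
  have [j ->] := nonzero_power pgK z0.
  rewrite /N (norm_form_gamma cardK gamma_prim omega_def).
  have e_gt0 : (0 < e)%N := dvdn_gt0 (prim_order_gt0 po) e_dvd.
  pose l := Ordinal (ltn_pmod j e_gt0).
  by rewrite (cyclo_union_expr po e_dvd _ (l := l)) ?(cyclo_union_expr pgK edK _ (l := l)).
pose E (i : 'I_d.+1) : {set K} := [set z | N z \in Y i].
have KE i : graphs_rel (fun i : 'I_d => Cay (cyclo_union gamma (A i))) i = Cay (E i).
  apply/setP => xy; rewrite /graphs_rel /E !inE.
  case: (unliftP ord0 i) => [h ->|->]; first by rewrite fam_cons_lift Yl NY inE.
  by rewrite fam_cons_0 Y0 !inE N0 subr_eq0.
have q1 := card_finNzRing_gt1 F.
have cN : #|{: restricted iota}| = (#|F| ^ (2 * 0).+2)%N by rewrite muln0 -cardK.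
(* The intersection numbers of the assumed scheme, read as level-set counts for the norm. *)
have meetN i j h z w : N z \in Y h -> N w \in Y h ->
    meet_count N z (Y i) (Y j) = meet_count N w (Y i) (Y j).
  move=> zh wh; have := @conv_count_Cay K d _ E i j h z w KE (proj1 A_fusion).
  rewrite !inE => /(_ zh wh).
  suff cm u : conv_count (E i) (E j) u = meet_count N u (Y i) (Y j) by rewrite !cm.
  by apply: eq_card => x; rewrite !inE.
have meetQ i j h (v w : V) : v != 0 -> w != 0 -> QV v \in Y h -> QV w \in Y h ->
    meet_count QV v (Y i) (Y j) = meet_count QV w (Y i) (Y j).
  move=> v0 w0 vh wh; case: (unliftP ord0 h) => [l hl|hl]; last first.
    rewrite hl Y0 !inE in vh wh.
    by apply: (meet_count_isotropic Qq Qnd cV); [| |exact/eqP|exact/eqP].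
  have nz c : c \in Y h -> c != 0.
    by rewrite hl Yl; apply: contraTneq => ->; apply: cyclo_union_neq0 po _.
  have cN2 : (#|F| ^ 2 <= #|{: restricted iota}|)%N by rewrite -cardK.
  (* The norm takes every nonzero value, so [z] and [z'] can stand in for [v] and [w]. *)
  have [z zE] := quadratic_onto Nq Nnd cN2 (nz _ vh).
  have [z' z'E] := quadratic_onto Nq Nnd cN2 (nz _ wh).
  apply: (meet_count_transfer Qq Qnd cV Nq Nnd cN _ (nz _ vh) (nz _ wh) zE z'E).
    (* The norm vanishes only at 0, so its slope in the affine formula is [1 - #|F|], which is
       nonzero. *)
    have -> : count_on N [set: restricted iota] 0 = 1%N.
      rewrite -(cards1 (0 : restricted iota)); congr #|pred_of_set _|.
      by apply/setP => x; rewrite !inE N0.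
    by rewrite muln0 expn0 muln1 => F1; rewrite -F1 in q1.
  by apply: (meetN i j h); rewrite ?zE ?z'E.
have RV i : graphs_rel (form_graphs Q omega A) i = Cay (form_class QV Y i).
  apply/setP => xy; rewrite /graphs_rel /form_class !inE.
  case: (unliftP ord0 i) => [h ->|->]; last by rewrite !fam_cons_0 !inE subr_eq0.
  rewrite !fam_cons_lift /form_graphs.
  case: (unliftP ord0 h) => [l ->|->]; first last.
    by rewrite fam_cons_0 Y0 !inE.
  (* No union of cyclotomic classes contains 0, so these level sets already omit the zero vector. *)
  rewrite fam_cons_lift Yl !inE andb_idl //; apply: contraTneq => ->.
  have -> : QV 0 = 0 by rewrite -(scale0r (0 : V)) (Qq.1) expr0n mul0r.
  exact: cyclo_union_neq0 po _.
split.
  apply: (association_scheme_Cay RV).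
  - by rewrite /form_class fam_cons_0.
  - exact: form_class_unique.
  - move=> i v; rewrite /form_class; case: (unliftP ord0 i) => [h ->|->].
      by rewrite fam_cons_lift !inE oppr_eq0 -scaleN1r (Qq.1) sqrrN expr1n mul1r.
    by rewrite fam_cons_0 !inE oppr_eq0.
  exact: (conv_count_form_class Qq Yu meetQ).
(* Each part [A l] contains some [x], and [Q] represents [omega ^+ x]; so only the graph of nonzero
   isotropic vectors can be empty. *)
move=> h; case: (unliftP ord0 h) => [l ->|->].
  rewrite /form_graphs fam_cons_lift => /setP emp.
  have [x Ax] : exists x, x \in A l.
    apply/set0Pn; case/and3P: A_part => _ _; apply: contraNneq => <-.
    by apply/imsetP; exists l.
  have cx : omega ^+ x \in cyclo_union omega (A l).
    by rewrite (cyclo_union_expr po e_dvd _ (l := x)) // modn_small.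
  have c0 : omega ^+ x != 0 by apply: contraTneq cx => ->; apply: cyclo_union_neq0 po _.
  have cV2 : (#|F| ^ 2 <= #|V|)%N by rewrite cV leq_exp2l.
  have [u uE] := quadratic_onto Qq Qnd cV2 c0.
  by have := emp (u, 0); rewrite !inE /= subr0 [Q u]uE cx.
rewrite /form_graphs fam_cons_0 => /setP emp; split=> //.
apply/setP => v; rewrite !inE; have := emp (v, 0); rewrite !inE /= subr0.
case: (eqVneq v 0) => //= -> _.
have -> : Q 0 = 0 by rewrite -(scale0r (0 : V)) (Qq.1 : forall a v, Q _ = _) expr0n mul0r.
by rewrite eqxx.
Qed.
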